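(* Let $f=(P,Q):\mathbb{C}^2\to\mathbb{C}^2$ be a polynomial map, with $P,Q\in\mathbb{C}[x,y]$ non-constant, $\deg_y P=\deg P$, $\deg_y Q=\deg Q$, and $J(P,Q)\not\equiv 0$. Suppose $\varphi\in\Pi$ is a dicritical series of $f$ with $a_\varphi=0$ and $b_\varphi<0$. Then either $\varphi$ is a singular series of $f$, or there is a horizontal series $\psi\in\Pi$ of $Q$ such that $\psi$ is a singular series of $f$ and $\psi\prec\varphi$.
   Context: $\mathbb{N}$ denotes the positive integers. $J(P,Q)=P_xQ_y-P_yQ_x$ is the Jacobian determinant. $\Pi$ is the set of all finite fractional power series of the form $$\varphi(x,\xi)=\sum_{k=1}^{n_\varphi-1}a_kx^{1-\frac{k}{m_\varphi}}+\xi x^{1-\frac{n_\varphi}{m_\varphi}},\qquad n_\varphi,m_\varphi\in\mathbb{N},\ a_k\in\mathbb{C},$$ where $\xi$ is a parameter and the common denominator $m_\varphi$ is taken minimal, i.e. $\gcd(\{m_\varphi,n_\varphi\}\cup\{k:a_k\neq0\})=1$. For $\psi,\varphi\in\Pi$, write $\psi\prec\varphi$ if $\varphi(x,\xi)=\psi(x,c+\text{lower terms in }x)$ for some $c\in\mathbb{C}$; here ''lower terms in $x$'' means a finite sum of terms with strictly negative fractional exponents of $x$ (with coefficients possibly depending on $\xi$). For $\varphi\in\Pi$ write, with lower terms having smaller exponents of $x$ and coefficients in $\mathbb{C}[\xi]$, $$P(x,\varphi(x,\xi))=p_\varphi(\xi)x^{a_\varphi/m_\varphi}+\text{lower terms in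 }x,\quad 0\ne p_\varphi\in\mathbb{C}[\xi],$$ $$Q(x,\varphi(x,\xi))=q_\varphi(\xi)x^{b_\varphi/m_\varphi}+\text{lower terms in }x,\quad 0\ne q_\varphi\in\mathbb{C}[\xi],$$ $$J(P,Q)(x,\varphi(x,\xi))=j_\varphi(\xi)x^{J_\varphi/m_\varphi}+\text{lower terms in }x,\quad 0\ne j_\varphi\in\mathbb{C}[\xi].$$ The numbers $a_\varphi,b_\varphi,J_\varphi$ are integers. $\varphi$ is a horizontal series of $P$ if $a_\varphi=0$ and $\deg p_\varphi>0$; it is a horizontal series of $Q$ if $b_\varphi=0$ and $\deg q_\varphi>0$. $\varphi$ is a dicritical series of $f$ if it is a horizontal series of $P$ or of $Q$ and $\max\{a_\varphi,b_\varphi\}=0$. $\varphi$ is a singular series of $f$ if $\deg j_\varphi>0$. *)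

(* Defs.v *)
From HB Require Import structures.
From mathcomp Require Import all_boot all_order all_algebra.
From mathcomp Require Export mpoly complex reals.

Set Implicit Arguments.
Unset Strict Implicit.
Unset Printing Implicit Defensive.

Import GRing.Theory.
Local Open Scope ring_scope.

(* In {mpoly F[2]}, the variable x has index ix and y has index iy. *)
Definition ix : 'I_2 := ord0.
Definition iy : 'I_2 := ord_max.

Definition tdeg (F : fieldType) (P : {mpoly F[2]}) : nat := (msize P).-1.

Definition ydeg (F : fieldType) (P : {mpoly F[2]}) : nat :=
  \max_(m <- msupp P) m iy.

Definition jacobian (F : fieldType) (P Q : {mpoly F[2]}) : {mpoly F[2]} :=
  mderiv ix P * mderiv iy Q - mderiv iy P * mderiv ix Q.

(* All expansions live in the field F(xi)(t), in which t plays the role of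
   x^(1/N) for a common denominator N.  In {poly {poly F}} the outer variable
   is t and the inner one is xi. *)
Definition puiseux (F : fieldType) := {fraction {poly {poly F}}}.

Definition tvar (F : fieldType) : puiseux F := tofrac ('X : {poly {poly F}}).

Definition pxi (F : fieldType) (p : {poly F}) : puiseux F := tofrac p%:P.

(* The record is the set Pi: coef k is a_k for 0 < k < num, and is normalized
   to 0 for the other k. *)
Record fseries (F : fieldType) := FSeries {
  den : nat;
  num : nat;
  coef : nat -> F;
  den_gt0 : (0 < den)%N;
  num_gt0 : (0 < num)%N;
  coef_supp : forall k, coef k != 0 -> (0 < k < num)%N;
  den_minimal :
    gcdn (gcdn den num) (\big[gcdn/0%N]_(1 <= k < num | coef k != 0) k) = 1%N
}.

(* phi(x, z), where x = t ^ (e * den phi); thus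
   x^(1 - k / den phi) = t ^ (e * (den phi - k)). *)
Definition feval (F : fieldType) (e : nat) (phi : fseries F) (z : puiseux F) :
    puiseux F :=
  \sum_(1 <= k < num phi)
     pxi (coef phi k)%:P * tvar F ^ (e%:Z * ((den phi)%:Z - k%:Z))
  + z * tvar F ^ (e%:Z * ((den phi)%:Z - (num phi)%:Z)).

(* P(x, phi(x, xi)), where x = t ^ den phi. *)
Definition fsubst (F : fieldType) (P : {mpoly F[2]}) (phi : fseries F) :
    puiseux F :=
  mmap (fun c : F => pxi c%:P)
       (fun i : 'I_2 =>
          if i == ix then tvar F ^+ den phi else feval 1 phi (pxi 'X)) P.

(* G = p(xi) t^a + lower terms in t, with p != 0 and coefficients in F[xi]. *)
Definition leading (F : fieldType) (G : puiseux F) (p : {poly F}) (a : int) :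
    Prop :=
  p != 0 /\
  exists (N : nat) (c : nat -> {poly F}),
    G = pxi p * tvar F ^ a + \sum_(1 <= k < N) pxi (c k) * tvar F ^ (a - k%:Z).

(* P(x, phi(x, xi)) = p(xi) x^(a / den phi) + lower terms in x; this determines
   p and a. *)
Definition expands (F : fieldType) (P : {mpoly F[2]}) (phi : fseries F)
    (p : {poly F}) (a : int) : Prop :=
  leading (fsubst P phi) p a.

(* phi(x, xi) = psi(x, c + lower terms in x), where e1 * den psi = e2 * den phi
   is a common denominator of all the exponents of x. *)
Definition fprec (F : fieldType) (psi phi : fseries F) : Prop :=
  exists (e1 e2 : nat) (c : F) (N : nat) (l : nat -> {poly F}),
    [/\ (0 < e1)%N, (0 < e2)%N, (e1 * den psi = e2 * den phi)%N &
        feval e2 phi (pxi 'X) =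
        feval e1 psi (pxi c%:P + \sum_(1 <= k < N) pxi (l k) * tvar F ^ (- k%:Z))].

Definition horizontal (F : fieldType) (P : {mpoly F[2]}) (phi : fseries F) :
    Prop :=
  exists p : {poly F}, expands P phi p 0 /\ (1 < size p)%N.

Definition dicritical (F : fieldType) (P Q : {mpoly F[2]}) (phi : fseries F) :
    Prop :=
  (horizontal P phi \/ horizontal Q phi) /\
  exists (p q : {poly F}) (a b : int),
    [/\ expands P phi p a, expands Q phi q b & Order.max a b = 0].

Definition singular (F : fieldType) (P Q : {mpoly F[2]}) (phi : fseries F) :
    Prop :=
  exists (j : {poly F}) (d : int),
    expands (jacobian P Q) phi j d /\ (1 < size j)%N.

(* Main.v *)
Require Import Defs.
From HB Require Import structures.
From mathcomp Require Import all_boot all_order all_algebra.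
From mathcomp Require Import mpoly complex reals.
From mathcomp Require Import ring zify.

(** Move up from phi, that is, consider for sigma > 0 the series
    phi(x, xi x^sigma) truncated at its new last exponent. The x-degree of P along this family is
    a convex nondecreasing piecewise linear function of sigma, and the degree
    in xi of its leading coefficient is the right slope. As a_phi = 0 and
    p_phi is not constant, P has positive degree and positive slope for every
    sigma > 0. As b_phi < 0 while deg_y Q = deg Q makes Q of positive degree
    near x^1, the degree of Q vanishes, with positive slope, at some
    sigma > 0; let psi be the series reached there. If P and Q have leading
    terms p x^a (a > 0) and q x^0 along psi, the chain rule shows that J(P, Q)
    has leading coefficient proportional to a p q', of positive degree in xi.
    So psi is horizontal for Q and singular. *)

Set Implicit Arguments.
Unset Strict Implicit.
Unset Printing Implicit Defensive.

Import Order.TTheory GRing.Theory Num.Theory.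
Local Open Scope ring_scope.

(** * Laurent polynomials in t over F[xi] *)

Section LaurentExpansions.

(* To be read with K = puiseux F, kap = pxi and t = tvar F. *)
Variables (F K : fieldType) (kap : {rmorphism {poly F} -> K}) (t : K).
Hypothesis t0 : t != 0.
Implicit Types (G u z : K) (W H : {poly {poly F}}) (p q : {poly F}) (a b : int).

Let Xi := kap 'X.

(* H(u, z), where u replaces the outer variable of H and z the inner one. *)
Definition bev (u z : K) : {poly {poly F}} -> K :=
  horner_eval u \o map_poly (horner_eval z \o map_poly (kap \o polyC)).

HB.instance Definition _ u z := GRing.RMorphism.on (bev u z).

Lemma bevX u z : bev u z 'X = u.
Proof. by rewrite /bev /= map_polyX /horner_eval hornerX. Qed.

Lemma bevC u z p : bev u z p%:P = (map_poly (kap \o polyC) p).[z].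
Proof. by rewrite /bev /= map_polyC /horner_eval hornerC. Qed.

Lemma bevCC u z (c : F) : bev u z c%:P%:P = kap c%:P.
Proof. by rewrite bevC map_polyC hornerC. Qed.

Lemma bevY u z : bev u z 'X%:P = z.
Proof. by rewrite bevC map_polyX hornerX. Qed.

Lemma bev_map_polyC u z p :
  bev u z (map_poly polyC p) = (map_poly (kap \o polyC) p).[u].
Proof.
rewrite -{1}[p]coefK poly_def !rmorph_sum /=.
rewrite (@horner_coef_wide _ (size p)) ?size_poly //; apply: eq_bigr => i _.
rewrite coef_map /= -mul_polyC !rmorphM /= map_polyXn (map_polyC polyC).
by rewrite rmorphXn /= bevX bevCC.
Qed.

Lemma bevE u z H :
  bev u z H = \sum_(k < size H) (map_poly (kap \o polyC) H`_k).[z] * u ^+ k.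
Proof.
rewrite -{1}[H]coefK poly_def rmorph_sum /=; apply: eq_bigr => k _.
by rewrite -mul_polyC rmorphM rmorphXn /= bevX bevC.
Qed.

Lemma bev_sum u z H :
  bev u z H = \sum_(k < size H) \sum_(j < size H`_k)
                kap (H`_k`_j)%:P * z ^+ j * u ^+ k.
Proof.
rewrite bevE; apply: eq_bigr => k _.
rewrite (@horner_coef_wide _ (size H`_k)) ?size_poly // mulr_suml.
by apply: eq_bigr => j _; rewrite coef_map.
Qed.

Lemma kap_horner p : (map_poly (kap \o polyC) p).[Xi] = kap p.
Proof.
rewrite map_poly_comp horner_map.
by rewrite -[(map_poly polyC p).['X]]/(comp_poly 'X p) comp_polyXr.
Qed.

(** The outer variable stands for 1/t, so a Laurent polynomial in t is [t ^ a * teval W], with the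
    lower terms in the higher coefficients of W. *)
Definition teval : {poly {poly F}} -> K := bev t^-1 (Xi).

HB.instance Definition _ := GRing.RMorphism.on teval.

Lemma tevalD : {morph teval : H1 H2 / H1 + H2}. Proof. exact: rmorphD. Qed.

Lemma tevalM : {morph teval : H1 H2 / H1 * H2}. Proof. exact: rmorphM. Qed.

Lemma tevalE H : teval H = \sum_(k < size H) kap H`_k * t ^- k.
Proof.
by rewrite /teval bevE; apply: eq_bigr => k _; rewrite kap_horner exprVn.
Qed.

Lemma tevalE_wide H n :
  (size H <= n)%N -> teval H = \sum_(k < n) kap H`_k * t ^- k.
Proof.
move=> sH; rewrite tevalE (big_ord_widen n (fun k => kap H`_k * t ^- k)) //.
rewrite big_mkcond; apply: eq_bigr => k _; case: ltnP => // /(nth_default 0) ->.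
by rewrite rmorph0 mul0r.
Qed.

Lemma tevalX : teval 'X = t^-1. Proof. exact: bevX. Qed.

Lemma tevalC p : teval p%:P = kap p.
Proof. by rewrite /teval bevC kap_horner. Qed.

Lemma tevalXn k : teval 'X^k = t ^- k.
Proof. by rewrite rmorphXn /= tevalX exprVn. Qed.

(** Says that [kap] is injective and that 1/t is transcendental over its image; this makes leading
    terms unique. *)
Hypothesis teval_eq0 : forall H, teval H = 0 -> H = 0.

Lemma teval_inj : injective teval.
Proof. by apply: raddf_inj => H /teval_eq0. Qed.

(* Unlike in [leading], the coefficient p may vanish. *)
Definition lead0 G p a := exists2 W, G = t ^ a * teval W & W`_0 = p.

Lemma lead0P G p a :
  (exists (N : nat) (c : nat -> {poly F}),
     G = kap p * t ^ a + \sum_(1 <= k < N) kap (c k) * t ^ (a - k%:Z)) <->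
  lead0 G p a.
Proof.
split=> [[N [c ->]]|[W -> W0]].
  exists (p%:P + \sum_(1 <= k < N) (c k)%:P * 'X^k).
    rewrite tevalD tevalC mulrDr mulrC; congr (_ + _).
    rewrite rmorph_sum mulr_sumr; apply: eq_bigr => k _ /=.
    rewrite tevalM tevalC tevalXn mulrCA; congr (_ * _).
    by rewrite expfzDr // exprnN.
  rewrite coefD coefC /= coef_sum big1_seq ?addr0 // => k /andP [_].
  rewrite mem_index_iota => /andP [k0 _].
  by rewrite coefCM coefXn; case: k k0 => //= k _; rewrite mulr0.
exists (size W).+1, (fun k => W`_k).
rewrite (tevalE_wide (leqnSn _)) big_ord_recl W0 expr0 invr1 mulr1 mulrDr mulrC.
congr (_ + _); rewrite mulr_sumr big_add1 /= big_mkord; apply: eq_bigr => i _.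
by rewrite /bump add1n mulrCA exprnN -expfzDr.
Qed.

Lemma lead0D G1 G2 p1 p2 a :
  lead0 G1 p1 a -> lead0 G2 p2 a -> lead0 (G1 + G2) (p1 + p2) a.
Proof.
move=> [W1 -> <-] [W2 -> <-]; exists (W1 + W2); last by rewrite coefD.
by rewrite rmorphD mulrDr.
Qed.

Lemma lead0N G p a : lead0 G p a -> lead0 (- G) (- p) a.
Proof.
move=> [W -> <-]; exists (- W); last by rewrite coefN.
by rewrite rmorphN mulrN.
Qed.

Lemma lead0_0 a : lead0 0 0 a.
Proof. by exists 0; rewrite ?coef0 // rmorph0 mulr0. Qed.

Lemma lead0_sum (I : Type) (r : seq I) (P : pred I) (G : I -> K)
    (p : I -> {poly F}) a :
  (forall i, P i -> lead0 (G i) (p i) a) ->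
  lead0 (\sum_(i <- r | P i) G i) (\sum_(i <- r | P i) p i) a.
Proof.
move=> h; elim/big_rec2: _ => [|i x y Pi ih]; first exact: lead0_0.
exact/lead0D/ih/h.
Qed.

Lemma lead0M G1 G2 p1 p2 a1 a2 :
  lead0 G1 p1 a1 -> lead0 G2 p2 a2 -> lead0 (G1 * G2) (p1 * p2) (a1 + a2).
Proof.
move=> [W1 -> <-] [W2 -> <-]; exists (W1 * W2); last by rewrite coef0M.
by rewrite rmorphM expfzDr ?t0 // mulrACA.
Qed.

Lemma lead0X G p n : lead0 G p 0 -> lead0 (G ^+ n) (p ^+ n) 0.
Proof.
move=> h; elim: n => [|n ih].
  by exists 1; rewrite ?rmorph1 ?mulr1 ?coef1.
by rewrite !exprS; have := lead0M h ih; rewrite addr0.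
Qed.

Lemma lead0_teval W : lead0 (teval W) W`_0 0.
Proof. by exists W; rewrite // expr0z mul1r. Qed.

Lemma lead0_kap p : lead0 (kap p) p 0.
Proof. by exists p%:P; rewrite ?tevalC ?coefC // expr0z mul1r. Qed.

Lemma lead0_tvar a : lead0 (t ^ a) 1 a.
Proof. by exists 1; rewrite ?rmorph1 ?mulr1 ?coef1. Qed.

(** Raising the exponent from a to b multiplies W by ['X^(b - a)], which kills its constant
    coefficient. *)
Lemma lead0_lt G p a b : lead0 G p a -> a < b -> lead0 G 0 b.
Proof.
move=> [W -> _] ab; exists ('X^(absz (b - a)) * W); last first.
  by rewrite coefXnM; case: ifP => //; lia.
rewrite rmorphM /= tevalXn mulrA exprnN -expfzDr ?t0 //.
by congr (t ^ _ * _); lia.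
Qed.

Lemma lead0_uniq G p q a b :
  p != 0 -> q != 0 -> lead0 G p a -> lead0 G q b -> a = b /\ p = q.
Proof.
have same p1 p2 a1 : lead0 G p1 a1 -> lead0 G p2 a1 -> p1 = p2.
  move=> [W1 -> <-] [W2 + <-] => /mulfI e; suff -> : W1 = W2 by []; apply: teval_inj.
  by apply: e; rewrite expfz_eq0 negb_and t0 orbT.
move=> p0 q0 hp hq; case: (ltgtP a b) => [ab|ba|eab].
- by have := same _ _ _ (lead0_lt hp ab) hq => e; rewrite -e eqxx in q0.
- by have := same _ _ _ hp (lead0_lt hq ba) => e; rewrite e eqxx in p0.
- by split=> //; subst b; apply: same hp hq.
Qed.


(** * The chain rule *)

Definition xideriv H := swapXY (swapXY H)^`().

Lemma xiderivD H1 H2 : xideriv (H1 + H2) = xideriv H1 + xideriv H2.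
Proof. by rewrite /xideriv !(raddfD, derivD). Qed.

Lemma xiderivM H1 H2 : xideriv (H1 * H2) = xideriv H1 * H2 + H1 * xideriv H2.
Proof. by rewrite /xideriv rmorphM derivM rmorphD !rmorphM /= !swapXYK. Qed.

Lemma xiderivC p : xideriv p%:P = p^`()%:P.
Proof. by rewrite /xideriv swapXY_polyC deriv_map swapXY_map_polyC. Qed.

Lemma xiderivXn k : xideriv 'X^k = 0.
Proof.
by rewrite /xideriv rmorphXn /= swapXY_X -rmorphXn /= derivC rmorph0.
Qed.

Lemma coef0_xideriv H : (xideriv H)`_0 = (H`_0)^`().
Proof.
apply/polyP => i.
by rewrite coef_swapXY coef_deriv coefMn coef_swapXY coef_deriv.
Qed.

(* Euler's operator [t d/dt] on [t ^ d * H(1/t)]. *)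
Definition euler (d : int) H := H *~ d - 'X * H^`().

(* G is a Laurent polynomial in t over F[xi], Gt = t dG/dt and Gz = dG/dxi. *)
Definition lau G Gt Gz : Prop := exists (d : int) H,
  [/\ G = t ^ d * teval H, Gt = t ^ d * teval (euler d H)
    & Gz = t ^ d * teval (xideriv H)].

Lemma tvar_shift d k H : t ^ (d + k%:Z) * teval ('X^k * H) = t ^ d * teval H.
Proof.
rewrite rmorphM /= tevalXn mulrA exprnN -expfzDr ?t0 //.
by rewrite addrK.
Qed.

Lemma euler_shift d k H : euler (d + k%:Z) ('X^k * H) = 'X^k * euler d H.
Proof.
rewrite /euler derivM derivXn mulrDr.
have -> : 'X * ('X^(k.-1) *+ k * H) = 'X^k * H *+ k.
  case: k => [|k]; first by rewrite !mulr0n mul0r mulr0.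
  by rewrite mulrnAl mulrnAr mulrA -exprS.
by rewrite mulrzDr -pmulrn mulrBr mulrzAr opprD addrA addrK mulrCA.
Qed.

Lemma xideriv_shift k H : xideriv ('X^k * H) = 'X^k * xideriv H.
Proof. by rewrite xiderivM xiderivXn mul0r add0r. Qed.

(** The pairs (d, H) and (d + k, X^k H) encode the same Laurent polynomial and the same derivatives,
    so two triples can be brought to a common d before they are added. *)
Lemma lau_shift d k H G Gt Gz :
  [/\ G = t ^ d * teval H, Gt = t ^ d * teval (euler d H)
    & Gz = t ^ d * teval (xideriv H)] <->
  [/\ G = t ^ (d + k%:Z) * teval ('X^k * H),
      Gt = t ^ (d + k%:Z) * teval (euler (d + k%:Z) ('X^k * H))
    & Gz = t ^ (d + k%:Z) * teval (xideriv ('X^k * H))].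
Proof. by rewrite euler_shift xideriv_shift !tvar_shift. Qed.

Lemma lauD G1 Gt1 Gz1 G2 Gt2 Gz2 :
  lau G1 Gt1 Gz1 -> lau G2 Gt2 Gz2 -> lau (G1 + G2) (Gt1 + Gt2) (Gz1 + Gz2).
Proof.
move=> [d1 [H1 h1]] [d2 [H2 h2]].
have [d [k1 [k2 [e1 e2]]]] :
    exists (d : int) (k1 k2 : nat), d = d1 + k1%:Z /\ d = d2 + k2%:Z.
  by exists (Num.max d1 d2), `|Num.max d1 d2 - d1|%N, `|Num.max d1 d2 - d2|%N; lia.
move/(lau_shift _ k1): h1; rewrite -e1 => -[-> -> ->].
move/(lau_shift _ k2): h2; rewrite -e2 => -[-> -> ->].
exists d, ('X^k1 * H1 + 'X^k2 * H2); rewrite xiderivD -!mulrDr -!tevalD; split=> //.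
by rewrite /euler derivD mulrzDl mulrDr opprD addrACA.
Qed.

Lemma lauM G1 Gt1 Gz1 G2 Gt2 Gz2 :
  lau G1 Gt1 Gz1 -> lau G2 Gt2 Gz2 ->
  lau (G1 * G2) (Gt1 * G2 + G1 * Gt2) (Gz1 * G2 + G1 * Gz2).
Proof.
move=> [d1 [H1 [-> -> ->]]] [d2 [H2 [-> -> ->]]]; exists (d1 + d2), (H1 * H2).
have e (x y : K) : t ^ d1 * x * (t ^ d2 * y) = t ^ (d1 + d2) * (x * y).
  by rewrite expfzDr ?t0 // mulrACA.
rewrite !e -!mulrDr -!tevalM -!tevalD xiderivM; split=> //.
congr (_ * teval _); rewrite /euler derivM mulrzDr.
rewrite mulrBl mulrBr addrACA mulrzAl mulrzAr -opprD mulrDr.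
by rewrite mulrA [in 'X * (H1 * _)]mulrCA.
Qed.

Lemma lau_kapC (c : F) : lau (kap c%:P) 0 0.
Proof.
exists 0, c%:P%:P; rewrite /euler xiderivC !derivC mulr0z mulr0 subr0 !rmorph0 !mulr0.
by rewrite expr0z mul1r tevalC.
Qed.

Lemma lau0 : lau 0 0 0.
Proof.
by have := lau_kapC 0; rewrite polyC0 rmorph0.
Qed.

Lemma lau_tvar a : lau (t ^ a) (t ^ a *~ a) 0.
Proof.
exists a, 1; rewrite /euler -[1]/(1%:P) xiderivC !derivC mulr0 subr0 !rmorph0 mulr0.
by rewrite (rmorph_int (teval)) mulrzr (rmorph1 (teval)) mulr1.
Qed.

Lemma lau_kap p : lau (kap p) 0 (kap p^`()).
Proof.
exists 0, p%:P; rewrite /euler xiderivC derivC mulr0z mulr0 subr0 rmorph0 mulr0.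
by split; rewrite // expr0z mul1r tevalC.
Qed.

Lemma lau_sum (I : Type) (r : seq I) (P : pred I) (G Gt Gz : I -> K) :
  (forall i, P i -> lau (G i) (Gt i) (Gz i)) ->
  lau (\sum_(i <- r | P i) G i) (\sum_(i <- r | P i) Gt i)
      (\sum_(i <- r | P i) Gz i).
Proof.
move=> h; elim/big_rec3: _ => [|i x1 x2 x3 Pi ih]; last exact/lauD/ih/h.
exact: lau0.
Qed.

(** If d were below a, comparing the two forms would make W divisible by ['X], against p != 0; so d
    >= a, and cancelling powers of t gives H. *)
Lemma lead0_shift (d : int) H p a :
  p != 0 -> lead0 (t ^ d * teval H) p a ->
  exists k W, [/\ d = a + k%:Z, H = 'X^k * W & W`_0 = p].
Proof.
move=> p0 [W eG W0].
have [k ek] : exists k : nat, d = a + k%:Z.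
  case: (leP a d) => [|da]; first by exists `|d - a|%N; lia.
  suff eW : W = 'X^`|a - d| * H.
    by move: p0; rewrite -W0 eW coefXnM ifT ?eqxx //; lia.
  apply: teval_inj; apply: (@mulfI _ (t ^ a)).
    by rewrite expfz_eq0 negb_and t0 orbT.
  by rewrite -eG -(tvar_shift d `|a - d|); congr (t ^ _ * _); lia.
exists k, W; split=> //; apply: teval_inj; apply: (@mulfI _ (t ^ d)).
  by rewrite expfz_eq0 negb_and t0 orbT.
by rewrite {2}ek tvar_shift -eG.
Qed.

(** Both derivations act term by term and do not raise the degree. Either new coefficient may
    vanish, which [lead0] allows. *)
Lemma lau_leading G Gt Gz p a :
  lau G Gt Gz -> p != 0 -> lead0 G p a ->
  lead0 Gt (p *~ a) a /\ lead0 Gz p^`() a.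
Proof.
move=> [d [H h]] p0 hG.
have [k [W [ek eH W0]]] : exists k W, [/\ d = a + k%:Z, H = 'X^k * W & W`_0 = p].
  by apply: lead0_shift => //; case: h => <-.
move: h; rewrite eH ek -lau_shift => -[_ -> ->]; split.
  exists (euler a W) => //.
  rewrite /euler coefB coefXM subr0 -W0.
  by case: a {hG ek} => n; [exact: coefMn | exact: coefMNn].
by exists (xideriv W); rewrite // coef0_xideriv W0.
Qed.

Definition ev (P : {mpoly F[2]}) x y : K :=
  mmap (kap \o polyC) (fun i : 'I_2 => if i == ix then x else y) P.

(** The property [L] holds for constants and variables and passes to sums and products by linearity
    and the Leibniz rule, hence to all P. *)
Lemma lau_ev P x xt xz y yt yz :
  lau x xt xz -> lau y yt yz ->
  lau (ev P x y)
      (xt * ev (mderiv ix P) x y + yt * ev (mderiv iy P) x y)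
      (xz * ev (mderiv ix P) x y + yz * ev (mderiv iy P) x y).
Proof.
move=> hx hy; pose L P := lau (ev P x y)
      (xt * ev (mderiv ix P) x y + yt * ev (mderiv iy P) x y)
      (xz * ev (mderiv ix P) x y + yz * ev (mderiv iy P) x y).
have LC c : L c%:MP.
  rewrite /L !mderivC /ev mmapC !rmorph0 !mulr0 addr0; exact: lau_kapC.
have LD P1 P2 : L P1 -> L P2 -> L (P1 + P2).
  move=> h1 h2; rewrite /L !mderivD /ev !rmorphD /= -/(ev _ _ _).
  have := lauD h1 h2; congr lau; rewrite /ev; ring.
have LM P1 P2 : L P1 -> L P2 -> L (P1 * P2).
  move=> h1 h2; rewrite /L !mderivM /ev !(rmorphD, rmorphM) /= -/(ev _ _ _).
  have := lauM h1 h2; congr lau; rewrite /ev; ring.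
have LX i : L 'X_i.
  have ei : (i == ix) || (i == iy) by case: i => -[|[]].
  have dX k l : mderiv k ('X_l : {mpoly F[2]}) = (l == k)%:R%:MP.
    rewrite mderivX mnm1E; case: eqP => [->|_]; last by rewrite scale0r mpolyC0.
    have -> : (U_(k) - U_(k) = 0)%MM by apply/mnmP => j; rewrite mnmBE mnm0E subnn.
    by rewrite scale1r mpolyX0.
  have kb (b : bool) : kap (b%:R)%:P = b%:R by rewrite polyC_natr rmorph_nat.
  rewrite /L !dX /ev mmapX mmap1U !mmapC /= !kb.
  by case/orP: ei => /eqP ->; rewrite !eqxx !mulr1 !mulr0 ?addr0 ?add0r.
have {}LX m : L 'X_[m].
  rewrite mpolyXE_id; apply: (big_ind L) => [||i _]; [exact: (LC 1)|exact: LM|].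
  by elim: (m i) => [|n ih]; [apply: (LC 1)|rewrite exprS; apply: LM].
elim/mpolyind: P => [|c m P _ _ ih]; first exact: (LC 0).
by apply: LD => //; rewrite -mul_mpolyC; apply: LM.
Qed.


(** * Edges of the Newton polygon *)

(** With u = x^(-1/m), this is phi(x, xi) / x when A collects the coefficients of phi; no negative
    power of u occurs. *)
Definition series_poly (A : {poly F}) (n : nat) : {poly {poly F}} :=
  map_poly polyC A + 'X%:P * 'X^n.

Lemma bev_series u z A n :
  bev u z (series_poly A n) = (map_poly (kap \o polyC) A).[u] + z * u ^+ n.
Proof. by rewrite rmorphD rmorphM rmorphXn /= bevX bevY bev_map_polyC. Qed.

(* [P(u ^- m, u ^- m * S(u, xi)) = u ^- (m * d) * subst_poly P m n A d] for
   [S = series_poly A n], provided d bounds the degree of P. *)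
Definition subst_poly (P : {mpoly F[2]}) (m n : nat) (A : {poly F}) (d : nat) :=
  \sum_(w <- msupp P) (P@_w)%:P%:P * 'X^(m * (d - mdeg w)) *
    series_poly A n ^+ w iy.

Lemma mdeg2 (w : 'X_{1.. 2}) : mdeg w = (w ix + w iy)%N.
Proof.
rewrite mdegE big_ord_recl big_ord1; congr (_ + w _)%N; exact: val_inj.
Qed.

Lemma mdeg_tdeg (P : {mpoly F[2]}) w : w \in msupp P -> (mdeg w <= tdeg P)%N.
Proof. by move/msize_mdeg_lt; rewrite /tdeg; case: (msize P). Qed.

Lemma ev_subst P m n A e z :
  ev P (t ^+ (e * m)) (t ^+ (e * m) * bev (t ^- e) z (series_poly A n)) =
  t ^+ (e * m * tdeg P) * bev (t ^- e) z (subst_poly P m n A (tdeg P)).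
Proof.
rewrite /ev /mmap /subst_poly rmorph_sum mulr_sumr /= !big_seq.
apply: eq_bigr => w /mdeg_tdeg wd.
rewrite !rmorphM !rmorphXn /= bevX bevCC /mmap1 big_ord_recl big_ord1.
have -> : lift ord0 ord0 = iy :> 'I_2 by apply: val_inj.
rewrite eqxx /= -/ix exprMn; set s := bev _ _ _.
rewrite mdeg2 in wd *; set k := (_ - (_ + _))%N.
have {wd} -> : tdeg P = (w ix + w iy + k)%N by rewrite /k subnKC.
have -> : (t ^- e) ^+ (m * k) = t ^- (e * m * k).
  by rewrite -exprVn -exprM mulnA exprVn.
rewrite -!exprM !mulnDr !exprD.
have := expf_neq0 (e * m * k) t0; move: (t ^+ (e * m * k)) => v v0.
by field.
Qed.

(** Since deg_y P = deg P = d, the monomial y^d occurs in P, and it alone contributes to xi^d: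
    [series_poly] has degree 1 in xi, with coefficient u^n there. *)
Lemma subst_poly_top P m n A :
  (0 < tdeg P)%N -> ydeg P = tdeg P ->
  (subst_poly P m n A (tdeg P))`_(n * tdeg P)`_(tdeg P) != 0.
Proof.
move=> d0 yd; set d := tdeg P in d0 yd *.
have [w0 w0P w0d] : exists2 w, w \in msupp P & w iy = d.
  rewrite -yd /ydeg; move: d0; rewrite -yd /ydeg.
  elim: (msupp P) => [|w s ih]; first by rewrite big_nil.
  rewrite big_cons; case: (leqP (w iy) (\max_(j <- s) j iy)) => h h0.
    have [w1 w1s e] := ih h0.
    by exists w1; rewrite ?inE ?w1s ?orbT // e; exact: esym (maxn_idPr h).
  by exists w; rewrite ?mem_head.
have dw w : w \in msupp P -> (w ix + w iy <= d)%N by move/mdeg_tdeg; rewrite mdeg2.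
clearbody d.
have uw w : w \in msupp P -> w iy = d -> w = w0.
  move=> wP wd; apply/mnmP => i.
  have : (i == ix) || (i == iy) by case: i => -[|[]].
  case/orP => /eqP ->; last by rewrite wd.
  by have := dw _ wP; have := dw _ w0P; lia.
have sS : size (swapXY (series_poly A n)) = 2 /\
    lead_coef (swapXY (series_poly A n)) = 'X^n.
  rewrite /series_poly rmorphD rmorphM rmorphXn /= swapXY_map_polyC.
  rewrite swapXY_polyC map_polyX swapXY_X -rmorphXn /= mulrC mul_polyC addrC.
  have sX : size ('X^n *: 'X : {poly {poly F}}) = 2.
    by rewrite size_scale ?size_polyX // monic_neq0 ?monicXn.
  split; first by rewrite size_polyDl ?sX // ltnS size_polyC leq_b1.
  by rewrite lead_coefDl ?lead_coefZ ?lead_coefX ?mulr1 // sX ltnS size_polyC leq_b1.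
case: sS => sS lS; rewrite -coef_swapXY rmorph_sum /= coef_sum.
have sSk k : size (swapXY (series_poly A n) ^+ k) = k.+1.
  by rewrite polySpred ?size_exp ?sS ?mul1n // expf_neq0 // -size_poly_eq0 sS.
rewrite (bigD1_seq w0) ?msupp_uniq //= big1_seq ?addr0 => [|w /andP[ww0 wP]].
  rewrite !rmorphM !rmorphXn /= swapXY_polyC map_polyC swapXY_X -rmorphXn -mulrA /=.
  have -> : mdeg w0 = d by rewrite mdeg2; have := dw _ w0P; lia.
  rewrite subnn muln0 expr0 mul1r coefCM w0d.
  have -> : (swapXY (series_poly A n) ^+ d)`_d = 'X^(n * d).
    by rewrite exprM -lS -lead_coef_exp lead_coefE sSk.
  by rewrite coefCM coefXn eqxx mulr1 -mcoeff_msupp.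
rewrite !rmorphM !rmorphXn /= swapXY_polyC map_polyC swapXY_X -rmorphXn -mulrA /=.
rewrite !coefCM [X in _ * (_ * X)]nth_default ?mulr0 // sSk.
have : w iy != d by apply: contraNneq ww0 => /(uw _ wP) ->.
by have := dw _ wP; lia.
Qed.

(** The support is finite. The predicate D serves to exclude j = 0 when f is a quotient by j. *)
Lemma support_min H (D : pred nat) (f : nat -> nat -> rat) k j :
  D j -> H`_k`_j != 0 ->
  exists k0 j0, [/\ D j0, H`_k0`_j0 != 0 &
    forall k j, D j -> H`_k`_j != 0 -> f k0 j0 <= f k j].
Proof.
have bound k1 j1 : H`_k1`_j1 != 0 -> (k1 < size H)%N /\ (j1 < sizeY H)%N.
  move=> h; split; last first.
    apply: leq_trans (max_size_coefXY H k1); rewrite ltnNge.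
    by apply: contra h => /(nth_default 0) ->.
  by rewrite ltnNge; apply: contra h => /(nth_default 0) ->; rewrite coef0.
move=> Dj h; have [kH jH] := bound _ _ h.
pose S := [pred x : 'I_(size H) * 'I_(sizeY H) | D x.2 && (H`_x.1`_x.2 != 0)].
have S0 : S (Ordinal kH, Ordinal jH) by rewrite /= Dj.
case: (arg_minP (fun x : 'I_(size H) * 'I_(sizeY H) => f x.1 x.2) S0).
move=> [k0 j0] /andP [/= D0 h0] m; exists k0, j0; split=> // k1 j1 D1 h1.
have [k1H j1H] := bound _ _ h1.
by have /= := m (Ordinal k1H, Ordinal j1H); apply; rewrite /= D1.
Qed.

(** With u = t^-e and xi replaced by (xi - C(1/t)) t^s, the monomial u^k xi^j gets degree s j - e k
    in t. The terms with e k - s j = mu contribute E(xi - C(0)); E has no constant term but is not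
    zero, so its degree is positive. *)
Lemma lead0_edge H (e s : nat) (C : {poly F}) (mu : int) k1 j1 :
  (0 < e)%N ->
  (forall k j, H`_k`_j != 0 -> mu <= (e * k)%:Z - (s * j)%:Z) ->
  H`_k1`_j1 != 0 -> (e * k1)%:Z - (s * j1)%:Z = mu ->
  (forall k, H`_k`_0 != 0 -> mu < (e * k)%:Z) ->
  exists2 p : {poly F}, (1 < size p)%N &
    lead0 (bev (t ^- e) ((Xi - teval (map_poly polyC C)) * t ^+ s) H) p (- mu).
Proof.
move=> e0 hmu h1 mu1 h0.
pose c k j := if (e * k)%:Z - (s * j)%:Z == mu then H`_k`_j else 0.
pose E : {poly F} := \sum_(k < size H) \poly_(j < size H`_k) c k j.
exists (E \Po ('X - (C`_0)%:P)); last first.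
  rewrite bev_sum /E (rmorph_sum (comp_poly _)) /=; apply: lead0_sum => k _.
  rewrite poly_def (rmorph_sum (comp_poly _)) /=; apply: lead0_sum => j _.
  rewrite comp_polyZ comp_Xn_poly.
  have -> : kap (H`_k`_j)%:P * ((Xi - teval (map_poly polyC C)) * t ^+ s) ^+ j
      * (t ^- e) ^+ k = (kap (H`_k`_j)%:P * (Xi - teval (map_poly polyC C)) ^+ j)
      * t ^ ((s * j)%:Z - (e * k)%:Z).
    rewrite exprMn -!mulrA; congr (_ * (_ * _)).
    by rewrite expfzDr // -exprnN -exprnP !exprM exprVn.
  have hl : lead0 (kap (H`_k`_j)%:P * (Xi - teval (map_poly polyC C)) ^+ j
      * t ^ ((s * j)%:Z - (e * k)%:Z)) ((H`_k`_j)%:P * ('X - (C`_0)%:P) ^+ j)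
      ((s * j)%:Z - (e * k)%:Z).
    rewrite -[X in lead0 _ X]mulr1 -[X in lead0 _ _ X]add0r.
    apply: lead0M (lead0_tvar _).
    rewrite -[X in lead0 _ _ X]add0r; apply: lead0M (lead0_kap _) _.
    apply: lead0X; apply: lead0D; first exact: lead0_kap.
    by apply: lead0N; have := lead0_teval (map_poly polyC C); rewrite coef_map.
  rewrite /c; case: eqP => [em|nem].
    by move: hl; rewrite mul_polyC -em opprB.
  rewrite scale0r; case: (eqVneq H`_k`_j 0) => [->|hkj].
    by rewrite polyC0 rmorph0 !mul0r; apply: lead0_0.
  by apply: lead0_lt hl _; have := hmu _ _ hkj; lia.
rewrite size_comp_poly2 ?size_XsubC //.
have cE j : E`_j = \sum_(k < size H) c k j.
  rewrite coef_sum; apply: eq_bigr => k _; rewrite coef_poly; case: ltnP => // h.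
  by rewrite /c nth_default // if_same.
have E0 : E`_0 = 0.
  rewrite cE big1 // => k _; rewrite /c; case: eqP => // em.
  by apply/eqP; apply: contraT => /h0; lia.
have k1H : (k1 < size H)%N.
  by rewrite ltnNge; apply: contra h1 => /(nth_default 0) ->; rewrite coef0.
(* As e > 0, a point of the edge is determined by j, so nothing cancels in degree j1. *)
have E1 : E`_j1 != 0.
  rewrite cE (bigD1 (Ordinal k1H)) //= big1 ?addr0 => [|k].
    by rewrite /c mu1 eqxx.
  rewrite -val_eqE /= /c => kk1; case: eqP => // em.
  by case/eqP: kk1; nia.
rewrite ltnNge; apply: contra E1 => /size1_polyC ->.
by rewrite E0 coefC if_same.
Qed.

(** * Truncation of a series *)

(** The formula of [feval] over the abstract field; for [puiseux F] the two are convertible. *)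
Definition sfeval (e : nat) (phi : fseries F) z : K :=
  \sum_(1 <= k < num phi)
     kap (coef phi k)%:P * t ^ (e%:Z * ((den phi)%:Z - k%:Z))
  + z * t ^ (e%:Z * ((den phi)%:Z - (num phi)%:Z)).

Definition head_poly (phi : fseries F) : {poly F} :=
  \poly_(k < num phi) coef phi k.

Lemma tvar_expB e m k : t ^ (e%:Z * (m%:Z - k%:Z)) = t ^+ (e * m) * (t ^- e) ^+ k.
Proof.
by rewrite mulrBr expfzDr // -!PoszM -exprVn -exprM exprVn exprnN exprnP.
Qed.

Lemma sfevalE e phi z :
  sfeval e phi z =
  t ^+ (e * den phi) * bev (t ^- e) z (series_poly (head_poly phi) (num phi)).
Proof.
rewrite /sfeval bev_series tvar_expB mulrDr; congr (_ + _); last by rewrite mulrCA.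
rewrite (@horner_coef_wide _ (num phi)); last first.
  exact: leq_trans (size_poly _ _) (size_poly _ _).
rewrite -(big_mkord xpredT (fun k =>
  (map_poly (kap \o polyC) (head_poly phi))`_k * (t ^- e) ^+ k)).
have c0 : coef phi 0 = 0 by apply/eqP; apply: contraT => /coef_supp.
rewrite big_ltn ?num_gt0 // coef_map coef_poly num_gt0 c0 /= polyC0 rmorph0.
rewrite mul0r add0r mulr_sumr; apply: eq_big_nat => k /andP [_ kn].
by rewrite tvar_expB coef_map coef_poly kn mulrCA.
Qed.

Lemma dvdn_biggcd d (P : pred nat) (r : seq nat) :
  (d %| \big[gcdn/0%N]_(k <- r | P k) k)%N = all (fun k => P k ==> (d %| k)%N) r.
Proof.
elim: r => [|k r ih]; first by rewrite big_nil dvdn0.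
by rewrite big_cons /=; case: (P k) => //=; rewrite dvdn_gcd ih.
Qed.

(** Dividing the denominator M, the last exponent N and all exponents of B by their common gcd g
    yields the minimal denominator that membership in Pi requires. *)
Lemma reduce_series (M N : nat) (B : {poly F}) :
  (0 < M)%N -> (0 < N)%N -> (size B <= N)%N -> B`_0 = 0 ->
  exists g psi, [/\ (0 < g)%N, M = (g * den psi)%N, N = (g * num psi)%N
    & B = head_poly psi \Po 'X^g].
Proof.
move=> M0 N0 BN B0.
pose g := gcdn (gcdn M N) (\big[gcdn/0%N]_(1 <= k < N | B`_k != 0) k).
have g0 : (0 < g)%N by rewrite !gcdn_gt0 M0.
have gM : (g %| M)%N by rewrite !(dvdn_trans (dvdn_gcdl _ _)) // dvdn_gcdl.
have gN : (g %| N)%N by rewrite (dvdn_trans (dvdn_gcdl _ _)) // dvdn_gcdr.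
have kN k : B`_k != 0 -> (0 < k < N)%N.
  move=> h; apply/andP; split.
    by rewrite lt0n; apply: contra h => /eqP ->; rewrite B0.
  by apply: leq_trans BN; rewrite ltnNge; apply: contra h => /(nth_default 0) ->.
have gk k : B`_k != 0 -> (g %| k)%N.
  move=> h; have : (g %| \big[gcdn/0]_(1 <= k < N | (B`_k != 0)%R) k)%N.
    exact: dvdn_gcdr.
  by rewrite dvdn_biggcd => /allP /(_ k); rewrite mem_index_iota h kN //=; apply.
have d0 : (0 < M %/ g)%N by rewrite divn_gt0 // dvdn_leq.
have n0 : (0 < N %/ g)%N by rewrite divn_gt0 // dvdn_leq.
have supp k : B`_(g * k)%N != 0 -> (0 < k < N %/ g)%N.
  by move/kN; rewrite muln_gt0 g0 /= ltn_divRL // mulnC.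
have minimal : gcdn (gcdn (M %/ g) (N %/ g))
    (\big[gcdn/0%N]_(1 <= k < (N %/ g)%N | B`_(g * k)%N != 0) k) = 1%N.
  set h := gcdn _ _.
  have h0 : (0 < h)%N by rewrite !gcdn_gt0 d0.
  (* A common divisor h of the quotients makes g h a common divisor of the original numbers, hence a
     divisor of g. *)
  have : (g * h %| g)%N.
    rewrite {2}/g !dvdn_gcd dvdn_biggcd.
    have hd : (h %| M %/ g)%N by rewrite !(dvdn_trans (dvdn_gcdl _ _)) // dvdn_gcdl.
    have hn : (h %| N %/ g)%N by rewrite (dvdn_trans (dvdn_gcdl _ _)) // dvdn_gcdr.
    rewrite -{1}(divnK gM) -{1}(divnK gN) ![(_ %/ g * g)%N]mulnC !dvdn_pmul2l // hd hn /=.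
    apply/allP => k _; apply/implyP => Bk.
    have := gk _ Bk => /dvdnP [q eq]; rewrite mulnC in eq; subst k.
    rewrite dvdn_pmul2l //.
    have : (h %| \big[gcdn/0]_(1 <= k < (N %/ g)%N | (B`_(g * k)%N != 0)%R) k)%N.
      exact: dvdn_gcdr.
    by rewrite dvdn_biggcd => /allP /(_ q); rewrite mem_index_iota Bk supp //=; apply.
  by move/(dvdn_leq g0); nia.
exists g, (@FSeries F (M %/ g) (N %/ g) (fun k => B`_(g * k)%N) d0 n0 supp minimal).
rewrite /= ![(g * (_ %/ g))%N]mulnC !divnK //; split=> //.
apply/polyP => i; rewrite coef_comp_poly_Xn // coef_poly /=.
case: ifP => [/dvdnP [q ->]|gi].
  rewrite mulnK // ltn_divRL // mulnC; case: ltnP => // h.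
  by rewrite nth_default // (leq_trans BN).
by apply/eqP; apply: contraFT gi => /gk.
Qed.

Lemma horner_comp_Xn (A : {poly F}) g u :
  (map_poly (kap \o polyC) (A \Po 'X^g)).[u] = (map_poly (kap \o polyC) A).[u ^+ g].
Proof. by rewrite map_comp_poly map_polyXn horner_comp hornerXn. Qed.

(** In X = 1/t, the head of phi is B + X^N C with N = e num - s and B of degree below N. Keeping B
    leaves X^N (C + z X^s), so the tail and the old parameter together form the new parameter. *)
Lemma truncate_series (phi : fseries F) (e s : nat) :
  (0 < e)%N -> (s < e * num phi)%N ->
  exists g psi C, [/\ (0 < g)%N, (g * den psi = e * den phi)%N &
    forall z, sfeval e phi z =
      sfeval g psi (teval (map_poly polyC C) + z * t ^- s)].
Proof.
move=> e0 se; set N := (e * num phi - s)%N.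
pose A := head_poly phi \Po 'X^e.
have N0 : (0 < N)%N by rewrite subn_gt0.
have A0 : A`_0 = 0.
  rewrite coef_comp_poly_Xn // dvdn0 div0n coef_poly num_gt0.
  by apply/eqP; apply: contraT => /coef_supp.
have B0 : (take_poly N A)`_0 = 0 by rewrite coef_take_poly N0.
have M0 : (0 < e * den phi)%N by rewrite muln_gt0 e0 den_gt0.
have [g [psi [g0 eM eN eB]]] := reduce_series M0 N0 (size_take_poly N A) B0.
have := poly_take_drop N A; rewrite eB; move: (drop_poly N A) => C eA.
exists g, psi, C; split=> // z.
rewrite !sfevalE -eM; congr (_ * _); rewrite !bev_series.
rewrite -exprVn -horner_comp_Xn -/A -eA.
rewrite [map_poly _ (_ + _)]rmorphD /= [map_poly _ (_ * _)]rmorphM /= map_polyXn.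
rewrite hornerD hornerM hornerXn horner_comp_Xn -!exprVn -addrA; congr (_ + _).
rewrite /teval bev_map_polyC mulrDl -!exprM -eN; congr (_ + _).
by rewrite -mulrA -exprD subnKC // ltnW.
Qed.

Lemma bev_comp_Xn u z H g : bev u z (H \Po 'X^g) = bev (u ^+ g) z H.
Proof.
rewrite comp_polyE rmorph_sum bevE; apply: eq_bigr => k _ /=.
by rewrite -mul_polyC rmorphM !rmorphXn /= bevX bevC.
Qed.

Definition evs (P : {mpoly F[2]}) (phi : fseries F) : K :=
  ev P (t ^+ den phi) (sfeval 1 phi Xi).

Lemma ev_sfeval P phi e z :
  ev P (t ^+ (e * den phi)) (sfeval e phi z) =
  t ^+ (e * den phi * tdeg P) *
    bev (t ^- e) z (subst_poly P (den phi) (num phi) (head_poly phi) (tdeg P)).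
Proof. by rewrite sfevalE ev_subst. Qed.

Lemma evsE P phi :
  evs P phi = t ^ (den phi * tdeg P)%:Z *
    teval (subst_poly P (den phi) (num phi) (head_poly phi) (tdeg P)).
Proof. by rewrite /evs; have := ev_sfeval P phi 1 Xi; rewrite !mul1n expr1 => ->. Qed.

Lemma poly_valuation H : H != 0 -> exists k W, H = 'X^k * W /\ W`_0 != 0.
Proof.
move=> H0.
have : exists k, H`_k != 0 by exists (size H).-1; rewrite -lead_coefE lead_coef_eq0.
move=> ex; case: (ex_minnP ex) => k Hk kmin; exists k, (drop_poly k H); split.
  rewrite -[LHS](poly_take_drop k) [_ * 'X^k]mulrC.
  suff -> : take_poly k H = 0 by rewrite add0r.
  apply/polyP => i; rewrite coef_take_poly coef0; case: ifP => // ik.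
  by apply/eqP; apply: contraTT ik => /kmin; rewrite -leqNgt.
by rewrite coef_drop_poly.
Qed.

(** Taking x = t^(g den psi) instead of x = t^(den psi) amounts to replacing t by t^g: degrees are
    multiplied by g and the leading coefficient is kept. *)
Lemma lead0_reduce P psi g p a :
  (0 < g)%N -> p != 0 -> lead0 (ev P (t ^+ (g * den psi)) (sfeval g psi Xi)) p a ->
  exists2 a', a = g%:Z * a' & lead0 (evs P psi) p a'.
Proof.
move=> g0 p0; rewrite ev_sfeval evsE; set H := subst_poly _ _ _ _ _.
rewrite -exprVn -bev_comp_Xn -/teval exprnP => h.
have [k [W [ek eH W0]]] := lead0_shift p0 h.
have H0 : H != 0.
  by apply: contra_neq p0 => e0; move/eqP: eH;
    rewrite e0 comp_poly0 eq_sym mulf_eq0 expf_eq0 polyX_eq0 andbF -W0 /=;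
    by move=> /eqP ->; rewrite coef0.
have [k' [V [eV V0]]] := poly_valuation H0.
have hV : lead0 (t ^ (g * den psi * tdeg P)%:Z * teval (H \Po 'X^g)) V`_0
    ((g * den psi * tdeg P)%:Z - (g * k')%:Z).
  exists (V \Po 'X^g); last by rewrite coef_comp_poly_Xn // dvdn0 div0n.
  rewrite eV comp_polyM comp_Xn_poly -exprM tevalM tevalXn mulrA.
  by rewrite exprnN -expfzDr.
have [ea ep] := lead0_uniq p0 V0 h hV.
exists ((den psi * tdeg P)%:Z - k'%:Z); first by rewrite ea; lia.
by exists V; rewrite // eV tevalM tevalXn mulrA exprnN -expfzDr.
Qed.

(** * The horizontal series of Q above phi *)

Hypothesis natr_eq0F : forall n, (n%:R == 0 :> F) = (n == 0%N).

(** Only the derivative in xi is made explicit; the one in t cancels in the Jacobian determinant. *)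
Lemma lau_series phi : exists Gt,
  lau (sfeval 1 phi Xi) Gt (t ^ ((den phi)%:Z - (num phi)%:Z)).
Proof.
have := lauD
  (lau_sum (index_iota 1 (num phi)) (P := xpredT) (fun k _ =>
     lauM (lau_kapC (coef phi k)) (lau_tvar (1%:Z * ((den phi)%:Z - k%:Z)))))
  (lauM (lau_kap 'X) (lau_tvar (1%:Z * ((den phi)%:Z - (num phi)%:Z)))).
rewrite [X in lau _ _ (X + _)]big1 => [|k _]; last by rewrite mul0r mulr0 addr0.
rewrite derivX (rmorph1 kap) mulr0 addr0 add0r.
rewrite [X in lau _ _ X]mul1r [X in lau _ _ (t ^ X)]mul1r => h.
by eexists; apply: h.
Qed.

Lemma size_gt1_neq0 p : (1 < size p)%N -> p != 0.
Proof. by rewrite -size_poly_gt0 => /ltnW. Qed.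

Lemma deriv_neq0 q : (1 < size q)%N -> q^`() != 0.
Proof.
move=> sq; apply: contraTneq sq => /(congr1 (fun r : {poly F} => r`_(size q).-2)).
rewrite coef_deriv coef0 -mulr_natr => /eqP; rewrite mulf_eq0 natr_eq0F.
case: (ltnP 1 (size q)) => // sq.
rewrite prednK; last by lia.
rewrite -lead_coefE lead_coef_eq0 => /orP [/eqP q0|]; last by lia.
by move: sq; rewrite q0 size_poly0.
Qed.

(** As x does not depend on xi, the chain rule gives P_t Q_xi - P_xi Q_t = J(P, Q) x_t y_xi, where
    the subscript t means t d/dt. Since Q has degree 0, Q_t has no term of degree 0, and the leading
    coefficient left is a p q'. *)
Lemma lead0_jacobian P Q phi p q a :
  lead0 (evs P phi) p a -> (1 < size p)%N -> 0 < a ->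
  lead0 (evs Q phi) q 0 -> (1 < size q)%N ->
  exists (j : {poly F}) d, (1 < size j)%N /\ lead0 (evs (jacobian P Q) phi) j d.
Proof.
move=> hp sp a0 hq sq.
have p0 : p != 0 by apply: size_gt1_neq0.
have q0 : q != 0 by apply: size_gt1_neq0.
have m0 : (den phi)%:R != 0 :> F by rewrite natr_eq0F -lt0n den_gt0.
have [yt ly] := lau_series phi.
have lx := lau_tvar (den phi).
have lP := lau_ev P lx ly; have lQ := lau_ev Q lx ly.
rewrite -exprnP -/(evs P phi) in lP; rewrite -exprnP -/(evs Q phi) in lQ.
have [hPt hPz] := lau_leading lP p0 hp.
have [hQt hQz] := lau_leading lQ q0 hq.
have h := lead0D (lead0M hPt hQz) (lead0N (lead0M hPz hQt)).
rewrite mulr0z mulr0 subr0 addr0 in h.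
(* The factor t^b / m inverts x_t y_xi = m t^m t^(m - n), where m = den phi and n = num phi. *)
set b := - ((den phi)%:Z + ((den phi)%:Z - (num phi)%:Z)).
have h2 := lead0M (lead0M (lead0_kap ((den phi)%:R^-1)%:P) (lead0_tvar b)) h.
move: h2; set G := (X in lead0 X); set j := (X in lead0 _ X) => h2.
exists j, (0 + b + a); split; last first.
  suff -> : evs (jacobian P Q) phi = G by [].
  rewrite /G /jacobian /evs /ev rmorphB !rmorphM /= -!/(ev _ _ _).
  rewrite -/(ev (mderiv iy P) _ _).
  have u : kap ((den phi)%:R^-1)%:P * t ^ b *
      (t ^+ den phi *~ den phi * t ^ ((den phi)%:Z - (num phi)%:Z)) = 1.
    have e1 : t ^ b * (t ^+ den phi * t ^ ((den phi)%:Z - (num phi)%:Z)) = 1.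
      by rewrite exprnP -!expfzDr // addNr expr0z.
    have e2 : kap ((den phi)%:R^-1)%:P * (den phi)%:R = 1.
      rewrite -(rmorph_nat kap) -rmorphM -polyC_natr -polyCM mulVf //.
      by rewrite polyC1 rmorph1.
    have -> : t ^+ den phi *~ den phi = (den phi)%:R * t ^+ den phi.
      by rewrite mulr_natl -pmulrn.
    by rewrite -[X in _ * X]mulrA mulrACA e2 e1 mulr1.
  move: u; move: (kap _ * _) => c; move: (_ *~ _) => x; move: (t ^ _) => y u.
  by rewrite -[LHS]mul1r -[X in X * _ = _]u; ring.
rewrite /j mulr1 mul_polyC size_scale ?invr_eq0 //.
case: a a0 {hp hPt hPz h h2 j} => // n n0.
rewrite -pmulrn -scaler_nat -scalerAl size_scale; last by rewrite natr_eq0F; lia.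
rewrite size_mul ?deriv_neq0 //.
by rewrite (polySpred (deriv_neq0 sq)) addnS ltn_addr.
Qed.

(** As s > 0, only C(0) remains in degree 0; this is the form that [fprec] requires. *)
Lemma lower_terms (C : {poly F}) (s : nat) : (0 < s)%N ->
  exists (N : nat) (l : nat -> {poly F}),
    teval (map_poly polyC C) + Xi * t ^- s =
    kap (C`_0)%:P + \sum_(1 <= k < N) kap (l k) * t ^ (- k%:Z).
Proof.
move=> s0.
have h1 := lead0_teval (map_poly polyC C).
have h2 := lead0M (lead0_kap 'X) (lead0_tvar (- s%:Z)).
have [|N [c e]] := (lead0P _ _ _).2 (lead0D h1 (lead0_lt (b := 0) h2 _)).
  by rewrite add0r oppr_lt0.
exists N, c; rewrite exprnN e expr0z mulr1 addr0 coef_map /=.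
by congr (_ + _); apply: eq_bigr => k _; rewrite sub0r.
Qed.

(** With x = t^(e m), psi arises by putting (xi - C(1/t)) t^s for xi. The ratio s / e is the least
    at which a monomial of Q containing xi reaches degree 0, so Q has degree 0 along psi. *)
Lemma truncation_horizontal P Q phi p q b :
  (0 < tdeg Q)%N -> ydeg Q = tdeg Q ->
  lead0 (evs P phi) p 0 -> (1 < size p)%N ->
  lead0 (evs Q phi) q b -> q != 0 -> b < 0 ->
  exists e g s psi (C : {poly F}), [/\ (0 < e)%N, (0 < g)%N, (0 < s)%N,
    (g * den psi = e * den phi)%N &
    [/\ forall z, sfeval e phi z =
          sfeval g psi (teval (map_poly polyC C) + z * t ^- s),
        exists2 r : {poly F}, (1 < size r)%N & lead0 (evs Q psi) r 0 &
        exists (r : {poly F}) a, [/\ (1 < size r)%N, 0 < a & lead0 (evs P psi) r a]]].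
Proof.
move=> dQ0 yQ hp sp hq q0 b0.
have p0 : p != 0 by apply: size_gt1_neq0.
pose m := den phi; pose n := num phi.
have m0 : (0 < m)%N := den_gt0 phi.
pose HP := subst_poly P m n (head_poly phi) (tdeg P).
pose HQ := subst_poly Q m n (head_poly phi) (tdeg Q).
have topQ : HQ`_(n * tdeg Q)`_(tdeg Q) != 0 by apply: subst_poly_top.
move: hp; rewrite evsE -/m -/n -/HP => /(lead0_shift p0) [kP [WP [ekP eHP WP0]]].
move: hq; rewrite evsE -/m -/n -/HQ => /(lead0_shift q0) [kQ [WQ [ekQ eHQ WQ0]]].
have {}ekP : kP = (m * tdeg P)%N by lia.
have suppP k j : HP`_k`_j != 0 -> (m * tdeg P <= k)%N.
  rewrite eHP coefXnM ekP; case: ltnP => //; rewrite coef0 eqxx //.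
have suppQ k j : HQ`_k`_j != 0 -> (m * tdeg Q < k)%N.
  rewrite eHQ coefXnM; case: ltnP; first by rewrite coef0 eqxx.
  by move=> *; lia.
have topP : HP`_(m * tdeg P)`_(size p).-1 != 0.
  by rewrite eHP coefXnM ekP ltnn subnn WP0 -lead_coefE lead_coef_eq0.
(* The slope [s / e] at which the expansion of Q reaches degree 0. *)
pose f (k j : nat) : rat := (k%:Z - (m * tdeg Q)%:Z)%:~R / j%:R.
have [k0 [e [e0 h0 kmin]]] := support_min f (D := leq 1) dQ0 topQ.
have {}kmin k j : (0 < j)%N -> HQ`_k`_j != 0 ->
    (k0%:Z - (m * tdeg Q)%:Z) * j%:Z <= (k%:Z - (m * tdeg Q)%:Z) * e%:Z.
  move=> j0 /(kmin _ _ j0); rewrite /f ler_pdivrMr ?ltr0n // mulrAC.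
  rewrite ler_pdivlMr ?ltr0n //.
  by rewrite -[j%:R]/(j%:Z%:~R) -[e%:R]/(e%:Z%:~R) -!intrM ler_int.
have k0m := suppQ _ _ h0.
(* With this s, the minimizing monomial u^k0 xi^e gets degree exactly 0. *)
pose s := (k0 - m * tdeg Q)%N.
have es : k0%:Z - (m * tdeg Q)%:Z = s%:Z by rewrite /s; lia.
have s0 : (0 < s)%N by rewrite subn_gt0.
(* Minimality against the top monomial u^(n d) xi^d, d = deg Q, gives s / e <= n - m < n, so the
   last exponent stays positive after truncation. *)
have se : (s < e * n)%N.
  have := kmin _ _ dQ0 topQ; rewrite es.
  have : (0 < m * tdeg Q * e)%N by rewrite !muln_gt0 m0 dQ0 e0.
  have := dQ0; move: (tdeg Q) => d; clear; nia.
have [g [psi [C [g0 eM trunc]]]] := truncate_series e0 se.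
exists e, g, s, psi, C; split=> //.
have truncXi : sfeval g psi Xi =
    sfeval e phi ((Xi - teval (map_poly polyC C)) * t ^+ s).
  by rewrite trunc mulfK ?expf_neq0 // addrC subrK.
split=> //.
  (* The value mu = e m deg Q stands for degree 0 of Q; monomials without xi lie strictly beyond it
     because b < 0. *)
  have [|||r sr hr] := lead0_edge (H := HQ) (s := s)
    (mu := (e * (m * tdeg Q))%:Z) C e0 _ h0.
  - move=> k [|j] h; first by have := suppQ _ _ h; nia.
    by have := kmin k j.+1 isT h; rewrite es; lia.
  - by nia.
  - by move=> k h; have := suppQ _ _ h; nia.
  have r0 : r != 0 by apply: size_gt1_neq0.
  have [|a ea ha] := @lead0_reduce Q psi g r 0 g0 r0.
    rewrite truncXi eM ev_sfeval -/HQ exprnP.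
    have := lead0M (lead0_tvar (e * m * tdeg Q)%N%:Z) hr.
    by rewrite mul1r mulnA subrr.
  by exists r => //; move: ha; suff -> : a = 0 by []; nia.
have [k1 [j1 [_ h1 mumin]]] := support_min (D := predT)
  (fun k j : nat => ((e * k)%:Z - (s * j)%:Z)%:~R : rat) isT topP.
pose mu := (e * k1)%:Z - (s * j1)%:Z.
have {}mumin k j : HP`_k`_j != 0 -> mu <= (e * k)%:Z - (s * j)%:Z.
  by move/(mumin _ _ isT); rewrite ler_int.
(* The monomial of P carrying the top term of p already gets degree s deg p > 0, so P has positive
   degree along psi and monomials without xi stay off the edge. *)
have mutop : mu < (e * (m * tdeg P))%:Z.
  by have := mumin _ _ topP; have : (0 < s * (size p).-1)%N; nia.
have [k h|r sr hr] := lead0_edge (H := HP) C e0 mumin h1 erefl.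
  by have := suppP _ _ h; nia.
have r0 : r != 0 by apply: size_gt1_neq0.
have [|a ea ha] := @lead0_reduce P psi g r ((e * m * tdeg P)%:Z - mu) g0 r0.
  rewrite truncXi eM ev_sfeval -/HP exprnP.
  have := lead0M (lead0_tvar (e * m * tdeg P)%N%:Z) hr.
  by rewrite mul1r.
exists r, a; split=> //; nia.
Qed.

End LaurentExpansions.

(** * The fraction field of F[xi][t] as an instance of the abstract setting *)

HB.instance Definition _ (F : fieldType) :=
  GRing.RMorphism.copy (@pxi F) (@tofrac {poly {poly F}} \o polyC).

Section Puiseux.

Variable F : fieldType.
Implicit Types (P : {mpoly F[2]}) (phi : fseries F) (p : {poly F}).

Let K : fieldType := puiseux F.
Let kap : {rmorphism {poly F} -> K} := @pxi F.
Let t : K := tvar F.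

Lemma tvar_neq0 : t != 0.
Proof. by rewrite tofrac_eq0 polyX_eq0. Qed.

(** Multiplying by [t ^+ size H] clears denominators and leaves a polynomial in t with the
    coefficients of H in reverse order; [tofrac] is injective on it. *)
Lemma teval_pxi_eq0 (H : {poly {poly F}}) : teval kap t H = 0 -> H = 0.
Proof.
move=> e; have : t ^+ size H * teval kap t H = 0 by rewrite e mulr0.
rewrite tevalE mulr_sumr.
rewrite (eq_bigr (fun k : 'I__ => tofrac ((H`_k)%:P * 'X^(size H - k)))); last first.
  move=> k _; rewrite mulrCA -expfB //.
  by rewrite [RHS]tofracM tofracXn.
rewrite -rmorph_sum => /eqP; rewrite tofrac_eq0 => /eqP e0.
apply/polyP => k; rewrite coef0.
case: (ltnP k (size H)) => [kH|?]; last by rewrite nth_default.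
have := congr1 (fun p : {poly {poly F}} => p`_(size H - k)) e0.
rewrite coef_sum coef0 (bigD1 (Ordinal kH)) //= coefCM coefXn eqxx mulr1.
rewrite big1 ?addr0 // => i; rewrite -val_eqE /= => ik; rewrite coefCM coefXn.
have -> : (size H - k == size H - i)%N = false.
  by apply/negbTE; have := ltn_ord i; move: ik; lia.
by rewrite mulr0.
Qed.

Lemma leadingP (G : K) p a : leading G p a <-> p != 0 /\ lead0 kap t G p a.
Proof. by split=> -[p0 /(lead0P kap tvar_neq0)]. Qed.

Lemma fevalE e phi (z : K) : feval e phi z = sfeval kap t e phi z.
Proof. by []. Qed.

End Puiseux.

(** * Singular horizontal series of Q below a dicritical series of f *)

Theorem theorem1p2 (R : realType) (P Q : {mpoly R[i][2]})
  (hP : (0 < tdeg P)%N) (hQ : (0 < tdeg Q)%N)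
  (hyP : ydeg P = tdeg P) (hyQ : ydeg Q = tdeg Q)
  (hJ : jacobian P Q != 0)
  (phi : fseries R[i]) (hphi : dicritical P Q phi)
  (p q : {poly R[i]}) (a b : int)
  (hp : expands P phi p a) (hq : expands Q phi q b)
  (ha : a = 0) (hb : b < 0) :
  singular P Q phi \/
  exists psi : fseries R[i],
    [/\ horizontal Q psi, singular P Q psi & fprec psi phi].
Proof.
(* The construction always delivers the second alternative. *)
right; subst a.
have nat0 (n : nat) : (n%:R == 0 :> R[i]) = (n == 0%N) by exact: pnatr_eq0.
have T0 := @tvar_neq0 R[i]; have inj := @teval_pxi_eq0 R[i].
case/leadingP: hp => p0 hp; case/leadingP: hq => q0 hq.
(* A dicritical phi is horizontal for P or for Q; b < 0 excludes Q, and uniqueness of leading terms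
   identifies p. *)
have sp : (1 < size p)%N.
  case: hphi => -[[r [/leadingP [r0 hr] sr]]|[r [/leadingP [r0 hr] sr]]] _.
    by have [_ ->] := lead0_uniq T0 inj p0 r0 hp hr.
  by have [eb _] := lead0_uniq T0 inj q0 r0 hq hr; rewrite eb in hb.
have [e [g [s [psi [C [e0 g0 s0 eM [trunc [r sr hr] [r' [a [sr' a0 hr']]]]]]]]]] :=
  truncation_horizontal T0 inj hQ hyQ hp sp hq q0 hb.
have [j [d [sj hj]]] := lead0_jacobian T0 inj nat0 hr' sr' a0 hr sr.
have [N [l el]] := lower_terms (@pxi R[i]) T0 C s0.
exists psi; split.
- by exists r; split=> //; apply/leadingP; split=> //; apply: size_gt1_neq0.
- by exists j, d; split=> //; apply/leadingP; split=> //; apply: size_gt1_neq0.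
exists g, e, C`_0, N, l; split=> //.
by rewrite !fevalE trunc el.
Qed.
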